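(* Let $r\ge 3$ and let $H$ be a min-marked $r$-uniform clique on at least $r+1$ vertices. Then $H$ has an agreeing linear order if and only if each subhypergraph of $H$ with $r+1$ vertices has an agreeing linear order.
   Context: All hypergraphs are finite. An $r$-uniform clique is a complete $r$-uniform hypergraph $H$ with no repeated edges, i.e. its edge set $E(H)$ consists of all $r$-element subsets of its vertex set $V(H)$. A min-marked $r$-uniform clique is an $r$-uniform clique together with, for each edge $e\in E(H)$, one marked vertex $A(e)\in e$. The subhypergraph of $H$ on a vertex set $U\subseteq V(H)$ is the one with vertex set $U$ whose edges are all edges $e\in E(H)$ with $e\subseteq U$, with the same marks. A linear order $L$ on the vertex set of a min-marked hypergraph is an agreeing linear order if $A(e)<_L v$ for every edge $e$ and every $v\in e\setminus\{A(e)\}$. *)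

(* Defs.v *)
From mathcomp Require Import all_boot.
Set Implicit Arguments.
Unset Strict Implicit.
Unset Printing Implicit Defensive.

(* Finite hypergraphs without repeated edges, whose vertices are drawn from
   an ambient finite type T.  The values of [mark] on sets that are not edges
   are junk: [agreeing] below only reads it on edges. *)
Record min_marked_hypergraph (T : finType) := MinMarkedHypergraph {
  vertices : {set T};
  edges : {set {set T}};
  mark : {set T} -> T;
  edges_sub : forall e, e \in edges -> e \subset vertices;
  mark_in : forall e, e \in edges -> mark e \in e
}.

Definition uniform_clique (T : finType) (r : nat)
    (H : min_marked_hypergraph T) : Prop :=
  edges H = [set e : {set T} | (e \subset vertices H) && (#|e| == r)].

Section Subhypergraph.
Variables (T : finType) (H : min_marked_hypergraph T) (U : {set T}).

Let sub_edges := [set e in edges H | e \subset U].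

Fact subhypergraph_edges_sub e : e \in sub_edges -> e \subset U.
Proof. by rewrite inE => /andP[]. Qed.

Fact subhypergraph_mark_in e : e \in sub_edges -> mark H e \in e.
Proof. by rewrite inE => /andP[/mark_in]. Qed.

Definition subhypergraph : min_marked_hypergraph T :=
  MinMarkedHypergraph subhypergraph_edges_sub subhypergraph_mark_in.

End Subhypergraph.

(* L is the strict relation <_L; its values outside V are unconstrained. *)
Definition strict_linear_order_on (T : finType) (V : {set T}) (L : rel T)
    : Prop :=
  [/\ {in V, irreflexive L},
      {in V & &, transitive L} &
      {in V &, forall x y, x != y -> L x y || L y x}].

Definition agreeing (T : finType) (H : min_marked_hypergraph T) (L : rel T)
    : Prop :=
  forall e, e \in edges H -> forall v, v \in e :\ mark H e -> L (mark H e) v.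

Definition has_agreeing_linear_order (T : finType)
    (H : min_marked_hypergraph T) : Prop :=
  exists L : rel T, strict_linear_order_on (vertices H) L /\ agreeing H L.

(* Main.v *)
Require Import Defs.
From mathcomp Require Import all_boot.
Set Implicit Arguments.
Unset Strict Implicit.
Unset Printing Implicit Defensive.

(** Call a vertex of a vertex set [W] dominating when it is the mark of every
    edge inside [W] that contains it.  The least vertex of an agreeing order
    on [W] is dominating ([dominating_of_agreeing_order]).  Conversely, if
    every nonempty subset of [W] has a dominating vertex, then an agreeing
    order on [W] is obtained by putting a dominating vertex first and
    recursing on the other vertices ([agreeing_order_of_dominating]).

    So everything reduces to finding a dominating vertex of each nonempty [W].
    This is trivial if [W] has at most [r] vertices, as there is at most one
    edge inside [W]; for [r + 1] vertices it follows from the hypothesis.  For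
    larger sets one argues by induction ([dominating_step]): each [W :\ x] has
    a dominating vertex [c x].  If two vertices dominate sets whose
    intersection contains them both and has at least [r] elements, they are
    equal, because some edge in the intersection contains both and has only
    one mark ([dominating_unique]).  Fix [v] and let [a = c v].  For the [x]
    other than [a] and [v], this forces [c x] to be [a] or [v], and always the
    same one of the two.  Hence one vertex [b] among [a] and [v] dominates
    [W :\ x] for all [x] different from [b], with at most one exception.
    Since an edge avoids at least two vertices of [W], this [b] dominates [W]
    ([dominating_glue]). *)

Lemma exists_intermediate_set (T : finType) (A B : {set T}) (r : nat) :
  A \subset B -> #|A| <= r <= #|B| ->
  exists e : {set T}, [/\ A \subset e, e \subset B & #|e| = r].
Proof.
move=> sAB; elim: r => [|r IHr] /andP[leAr lerB].
  by exists A; split=> //; apply/eqP; rewrite -leqn0.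
have [eqA|neA] := eqVneq #|A| r.+1; first by exists A.
have ltAr : #|A| <= r by rewrite -ltnS ltn_neqAle neA.
have [|e [sAe seB card_e]] := IHr; first by rewrite ltAr ltnW.
have /properP[_ [x xB xe]] : e \proper B by rewrite properEcard seB card_e.
exists (x |: e); split; last by rewrite cardsU1 xe card_e.
  exact: subset_trans sAe (subsetUr _ _).
by rewrite subUset sub1set xB.
Qed.

Lemma strict_linear_order_onS (T : finType) (V W : {set T}) (L : rel T) :
  W \subset V -> strict_linear_order_on V L -> strict_linear_order_on W L.
Proof.
move=> /subsetP sWV [irr tr tot]; split.
- exact: sub_in1 irr.
- exact: sub_in3 tr.
- exact: sub_in2 tot.
Qed.

(** The least element is the one with the most elements above it. *)
Lemma strict_linear_order_min (T : finType) (W : {set T}) (L : rel T) :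
  strict_linear_order_on W L -> W != set0 ->
  exists2 a, a \in W & {in W, forall y, y != a -> L a y}.
Proof.
move=> [irr tr tot] /set0Pn[x0 x0W].
pose above x := [set y in W | L x y].
case: (arg_maxnP (fun x => #|above x|) x0W) => a /= aW a_max; exists a => //.
have {}aW : a \in W by [].
move=> y yW ya; have /orP[Lya|//] := tot _ _ yW aW ya.
suff : #|above a| < #|above y| by rewrite ltnNge; have /= -> := a_max y yW.
apply/proper_card/properP; split; last first.
  exists a; first by rewrite inE aW.
  by rewrite inE aW /= irr.
apply/subsetP=> z; rewrite !inE => /andP[zW Laz].
by rewrite zW; apply: tr Lya Laz.
Qed.

Section Dominating.
Variables (T : finType) (H : min_marked_hypergraph T).
Implicit Types (U W : {set T}) (L : rel T).

Definition dominating W a :=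
  (a \in W) &&
  [forall e in edges H, (e \subset W) && (a \in e) ==> (mark H e == a)].

Lemma dominatingP W a :
  reflect (a \in W /\ forall e, e \in edges H -> e \subset W -> a \in e ->
             mark H e = a)
          (dominating W a).
Proof.
apply: (iffP andP) => -[aW dom]; split=> //.
  by move=> e eE eW ae; apply/eqP/(implyP (forall_inP dom e eE)); rewrite eW.
by apply/forall_inP=> e eE; apply/implyP=> /andP[eW ae]; apply/eqP/dom.
Qed.

(** If an edge inside [W] contained the least vertex [a] and had another mark
    [m], then [m] would lie below [a]. *)
Lemma dominating_of_agreeing_order W :
  W != set0 -> has_agreeing_linear_order (subhypergraph H W) ->
  exists a, dominating W a.
Proof.
move=> W0 [L [ord agr]].
have [a aW a_min] := strict_linear_order_min ord W0.
exists a; apply/dominatingP; split=> // e eE eW ae.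
apply/eqP/negPn/negP=> mark_a; have mW := subsetP eW _ (mark_in eE).
have eE' : e \in edges (subhypergraph H W) by rewrite inE eE.
have Lma : L (mark H e) a by apply: (agr e eE'); rewrite !inE eq_sym mark_a.
have [irr tr _] := ord.
by have := tr _ _ _ mW aW aW (a_min _ mW mark_a) Lma; rewrite irr.
Qed.

(** An edge containing the dominating vertex [a] is marked [a], and [a] comes
    first; any other edge lies inside [W :\ a], where the order is the one
    given by induction. *)
Lemma agreeing_order_of_dominating W :
  (forall U, U \subset W -> U != set0 -> exists a, dominating U a) ->
  has_agreeing_linear_order (subhypergraph H W).
Proof.
have [n] := ubnP #|W|; elim: n W => // n IHn W ltWn domW.
have [W0|W0] := eqVneq W set0.
  exists (fun _ _ => false); split.
    by split=> x; rewrite /= W0 inE.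
  move=> e; rewrite inE W0 subset0 => /andP[eE /eqP e0].
  by have := mark_in eE; rewrite {2}e0 inE.
have [a /dominatingP[aW dom_a]] := domW W (subxx W) W0.
have [||L [[irr tr tot] agr]] := IHn (W :\ a).
- by rewrite (cardsD1 a) aW in ltWn.
- by move=> U /subset_trans sU; apply/domW/sU/subsetDl.
exists (fun x y => (y != a) && ((x == a) || L x y)); split; [split|] => /=.
- move=> x xW; have [//|xa /=] := eqVneq x a.
  by apply: irr; rewrite /= !inE xa.
- move=> y x z yW xW zW /andP[ya Lxy] /andP[za Lyz]; rewrite za /=.
  have [//|xa /=] := eqVneq x a.
  rewrite (negPf xa) (negPf ya) /= in Lxy Lyz.
  by apply: tr Lxy Lyz; rewrite /= !inE ?ya ?xa ?za.
- move=> x y xW yW xy; have [xa|xa] := eqVneq x a.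
    by rewrite -xa eq_sym xy.
  have [//|ya /=] := eqVneq y a.
  by apply: tot; rewrite //= !inE ?xa ?ya.
move=> e; rewrite inE => /andP[eE eW] v; rewrite !inE => /andP[vm ve].
have [ae|aNe] := boolP (a \in e).
  by rewrite -(dom_a e eE eW ae) vm eqxx.
have -> /= : v != a by apply: contraNneq aNe => <-.
by rewrite (agr e) ?orbT // !inE ?vm ?ve // eE subsetD1 eW.
Qed.

End Dominating.

Section Clique.
Variables (T : finType) (r : nat) (H : min_marked_hypergraph T).
Hypotheses (r_gt1 : 1 < r) (hclique : uniform_clique r H).
Implicit Types (U W : {set T}).

Local Notation V := (vertices H).
Local Notation dominating := (dominating H).

Lemma clique_edgeE e : (e \in edges H) = (e \subset V) && (#|e| == r).
Proof. by rewrite hclique inE. Qed.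

Lemma dominating_small W :
  W \subset V -> W != set0 -> #|W| <= r -> exists a, dominating W a.
Proof.
move=> WV /set0Pn[x xW]; rewrite leq_eqVlt => /orP[/eqP Wr|ltWr].
  have WE : W \in edges H by rewrite clique_edgeE WV Wr eqxx.
  exists (mark H W); apply/dominatingP; split=> [|e]; first exact: mark_in.
  rewrite clique_edgeE => /andP[_ /eqP er] eW _.
  by congr mark; apply/eqP; rewrite eqEcard eW er Wr leqnn.
exists x; apply/dominatingP; split=> // e.
rewrite clique_edgeE => /andP[_ /eqP er] /subset_leq_card.
by rewrite er leqNgt ltWr.
Qed.

(** Some edge inside [U :&: W] contains both [a] and [b], so its mark is equal
    to both. *)
Lemma dominating_unique U W a b :
  U \subset V -> r <= #|U :&: W| -> a \in W -> b \in U ->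
  dominating U a -> dominating W b -> a = b.
Proof.
move=> UV ler aW bU /dominatingP[aU dom_a] /dominatingP[bW dom_b].
have [||e [sabe]] := @exists_intermediate_set _ [set a; b] (U :&: W) r.
- by apply/subsetP=> x /set2P[]->; rewrite inE ?aU ?bU.
- by rewrite ler cards2 andbT; case: (a != b) => //; apply: ltnW.
rewrite subsetI => /andP[eU eW] er.
have eE : e \in edges H by rewrite clique_edgeE er (subset_trans eU) /=.
rewrite -(dom_a e) // ?(dom_b e) //; apply: (subsetP sabe).
  exact: set22.
exact: set21.
Qed.

(** An edge misses two vertices of [W], and at least one of them is not the
    exceptional vertex [z]. *)
Lemma dominating_glue W b z :
  r.+2 <= #|W| -> b \in W ->
  {in W, forall x, x != b -> x != z -> dominating (W :\ x) b} ->
  dominating W b.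
Proof.
move=> ltrW bW dom; apply/dominatingP; split=> // e eE eW be.
have /eqP er : #|e| == r by move: eE; rewrite clique_edgeE => /andP[].
have /properP[_ [x xW]] : z |: e \proper z |: W.
  rewrite properEcard setUS //=.
  rewrite (leq_trans _ (subset_leq_card (subsetUr _ _))) //.
  by rewrite cardsU1 er; apply: leq_ltn_trans ltrW; case: (z \notin e).
rewrite !inE negb_or => /andP[xz xe].
move: xW; rewrite !inE (negPf xz) /= => xW.
have xb : x != b by apply: contraNneq xe => ->.
by have /dominatingP[_ ->] := dom x xW xb xz; rewrite // subsetD1 eW.
Qed.

(** With [c x] a dominating vertex of [W :\ x] for each [x] and [a = c v], the
    vertex [a] dominates [W] unless it fails to dominate [W :\ x] for some
    [x != a].  Such an [x] has [c x = v], and this propagates: [c y = v] for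
    all [y] other than [a] and [v], so that [v] dominates [W]. *)
Lemma dominating_step W :
  W \subset V -> r.+2 <= #|W| ->
  {in W, forall x, exists a, dominating (W :\ x) a} ->
  exists a, dominating W a.
Proof.
move=> WV ltrW domW.
have /set0Pn[v vW] : W != set0 by rewrite -card_gt0; apply: leq_trans ltrW.
have [a dom_a] := domW v vW; have /dominatingP[/setD1P[av aW] _] := dom_a.
have same x y b c : x \in W -> y \in W -> x != y -> b != y -> c != x ->
    dominating (W :\ x) b -> dominating (W :\ y) c -> b = c.
  move=> xW yW xy by_ cx dom_b dom_c.
  have /dominatingP[/setD1P[_ bW] _] := dom_b.
  have /dominatingP[/setD1P[_ cW] _] := dom_c.
  apply: (@dominating_unique (W :\ x) (W :\ y)) dom_b dom_c.
  - exact: subset_trans (subsetDl _ _) WV.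
  - have -> : (W :\ x) :&: (W :\ y) = W :\ x :\ y.
      apply/setP=> t; rewrite !inE.
      by case: (t \in W); rewrite ?andbF ?andbT // andbC.
    move: ltrW; rewrite (cardsD1 x W) (cardsD1 y (W :\ x)) !inE xW yW.
    by rewrite eq_sym xy.
  - by rewrite !inE by_.
  - by rewrite !inE cx.
have [all_a|] := boolP [forall x in W, (x != a) ==> dominating (W :\ x) a].
  exists a; apply: (@dominating_glue W a a) => // x xW xa _.
  exact: (implyP (forall_inP all_a x xW)).
rewrite negb_forall_in => /exists_inP[x xW].
rewrite negb_imply => /andP[xa Ndom_a].
have xv : x != v by apply: contraNneq Ndom_a => ->.
have a_or_v y c : y \in W -> y != a -> y != v -> dominating (W :\ y) c ->
    c != v -> c = a.
  by move=> yW ya yv dom_c cv; apply: (same y v) => //; rewrite eq_sym.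
have dom_v : dominating (W :\ x) v.
  have [c dom_c] := domW x xW; have [<- //|cv] := eqVneq c v.
  by rewrite -(a_or_v x c) ?dom_c in Ndom_a.
exists v; apply: (@dominating_glue W v a) => // y yW yv ya.
have [c dom_c] := domW y yW; have [<- //|cv] := eqVneq c v.
have ca := a_or_v y c yW ya yv dom_c cv.
have yx : y != x by apply: contraNneq Ndom_a => <-; rewrite -ca.
by rewrite -(same y x c v) // 1?eq_sym // ca.
Qed.

Lemma exists_dominating W :
  (forall U, U \subset V -> #|U| = r.+1 -> exists a, dominating U a) ->
  W \subset V -> W != set0 -> exists a, dominating W a.
Proof.
move=> dom_r1; have [n] := ubnP #|W|; elim: n W => // n IHn W ltWn WV W0.
have [leWr|] := leqP #|W| r; first exact: dominating_small.
rewrite leq_eqVlt => /orP[/eqP Wr|ltrW]; first exact: dom_r1.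
apply: dominating_step => // x xW.
have Wx : #|W| = #|W :\ x|.+1 by rewrite (cardsD1 x) xW.
apply: IHn; first by rewrite Wx in ltWn.
  exact: subset_trans (subsetDl _ _) WV.
by rewrite -card_gt0; rewrite Wx ltnS in ltrW; apply: leq_trans ltrW.
Qed.

End Clique.

Theorem theorem2 (T : finType) (r : nat) (H : min_marked_hypergraph T)
    (hr : 3 <= r) (hclique : uniform_clique r H)
    (hcard : r.+1 <= #|vertices H|) :
  has_agreeing_linear_order H <->
  (forall U : {set T}, U \subset vertices H -> #|U| = r.+1 ->
     has_agreeing_linear_order (subhypergraph H U)).
Proof.
split=> [[L [ord agr]] U UV _|small].
  exists L; split; first exact: strict_linear_order_onS UV ord.
  by move=> e; rewrite inE => /andP[eE _]; apply: agr.
have [|L [ord agr]] := @agreeing_order_of_dominating T H (vertices H).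
  move=> U UV; apply: (exists_dominating _ hclique _ UV); first exact: ltnW.
  move=> {UV}U UV Ur; apply: dominating_of_agreeing_order (small U UV Ur).
  by rewrite -card_gt0 Ur.
exists L; split=> // e eE; apply: agr.
by rewrite inE eE (edges_sub eE).
Qed.
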